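(* Let $(\mathcal F,\preceq)$ be an intersection system on the finite set $N$, indexed as below, let $f\in\mathbb R^N_+$, and let $\bar y$ be the output of a run of the Monge algorithm on input $f$. Then for every valuation $v=\sum_{F\in\mathcal F}\beta_F\zeta^F$, $$\sum_{F\in\mathcal F}\bar y_Fv(F)=\int_{\mathcal F} f\,dv=\sum_{F\in\mathcal F}\beta_F\int_{\mathcal F} f\,d\zeta^F.$$
   Context: An ordered system is a pair $(\mathcal F,\preceq)$ with $\mathcal F$ a family of non-empty subsets of a finite set $N$ covering $N$ and $\preceq$ a partial order on $\mathcal F$; index $\mathcal F=\{F_1,\dots,F_m\}$ so that $F_i\succeq F_j$ implies $i\le j$. For $X\subseteq N$ let $\mathcal F(X)=\{F\in\mathcal F\mid F\subseteq X\}$. The system is consecutive if $F\cap H\subseteq G$ whenever $F\preceq G\preceq H$. A consecutive ordered system is an intersection system if for every $F\in\mathcal F$: (IS0) for every $G\in\mathcal F$ with $F\cap G\ne\emptyset$ there is some $F\vee G\in\mathcal F(F\cup G)$ with $F,G\preceq F\vee G$; (IS1) for all $G,H$ in the upper interval $[F)=\{G\in\mathcal F\mid G\succeq F\}$ there exist $G\vee H,G\wedge H\in\mathcal F(G\cup H)$ with $F\preceq G\wedge H\preceq G,H\preceq G\vee H$. A valuation is any $v:\mathcal F\to\mathbb R$; for $F\in\mathcal F$ the simple function $\zeta^F$ is $\zeta^F(G)=1$ iff $G\succeq F$, else $0$; each valuation has a unique expansion $v=\sum_F\beta_F\zeta^F$. For a belief function ($\beta_F\ge0$ for all $F$) and $f\in\mathbb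 R^N_+$: $\int_{\mathcal F} f\,dv:=\min\{\langle f,x\rangle\mid x\in\mathbb R^N_+,\ x(G)\ge v(G)\ \forall G\in\mathcal F\}$ with $x(G)=\sum_{i\in G}x_i$; for general $v$, $\int_{\mathcal F} f\,dv:=\int_{\mathcal F} f\,dv^+-\int_{\mathcal F} f\,dv^-$ where $v^+=\sum_{\beta_F\ge0}\beta_F\zeta^F$, $v^-=\sum_{\beta_F\le0}(-\beta_F)\zeta^F$. Monge algorithm on input $f$: initialize $X=N$, $c=f$, $y=0\in\mathbb R^{\mathcal F}$; repeat: let $M=F_i$ be the member of $\mathcal F(X)$ of minimal index, choose $p\in M$ with $c_p=\min_{j\in M}c_j$, set $y_M:=c_p$, $c:=c-c_p\mathbf 1_M$, $X:=X\setminus\{p\}$; stop when $\mathcal F(X)=\emptyset$, output $y$. *)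

(* Defs.v *)
From HB Require Import structures.
From mathcomp Require Import all_boot all_order all_algebra.
From mathcomp Require Import all_classical all_reals all_analysis.

Set Implicit Arguments.
Unset Strict Implicit.
Unset Printing Implicit Defensive.

Import Order.TTheory GRing.Theory Num.Theory.
Import numFieldTopology.Exports numFieldNormedType.Exports.

Local Open Scope classical_set_scope.
Local Open Scope ring_scope.

Record ordered_system (N : finType) := OrderedSystem {
  system_family : {set {set N}};
  prec : rel {F : {set N} | F \in system_family};
  family_neq0 : finset.set0 \notin system_family;
  family_cover : finset.cover system_family = [set: N]%SET;
  prec_refl : reflexive prec;
  prec_anti : antisymmetric prec;
  prec_trans : transitive prec
}.

Definition member (N : finType) (S : ordered_system N) : finType :=
  {F : {set N} | F \in system_family S}.

Section OrderedSystems.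
Variables (N : finType) (S : ordered_system N).
Implicit Types F G H : member S.

Definition consecutive : Prop :=
  forall F G H, prec F G -> prec G H -> val F :&: val H \subset val G.

(* The elements J and M below play the roles of joins and meets, but are only
   required to be an upper and a lower bound, not extremal ones. *)
Definition IS0 F : Prop :=
  forall G, val F :&: val G != finset.set0 ->
  exists J : member S,
    [/\ val J \subset val F :|: val G, prec F J & prec G J].

Definition IS1 F : Prop :=
  forall G H, prec F G -> prec F H ->
  exists J M : member S,
    [/\ val J \subset val G :|: val H, val M \subset val G :|: val H, prec F M,
        prec M G /\ prec M H & prec G J /\ prec H J].

Definition intersection_system : Prop :=
  consecutive /\ forall F, IS0 F /\ IS1 F.

(* An enumeration F_1, ..., F_m of the family without repetition, in which
   larger elements come first. *)
Definition indexing (m : nat) (idx : 'I_m -> member S) : Prop :=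
  bijective idx /\ forall i j : 'I_m, prec (idx j) (idx i) -> (i <= j)%N.

End OrderedSystems.

Section Integral.
Variables (R : realType) (N : finType) (S : ordered_system N).
Implicit Types (F G : member S) (v b : member S -> R) (f x : N -> R).

Definition zeta F : member S -> R := fun G => (prec F G)%:R.

Definition expansion b : member S -> R :=
  fun G => \sum_F b F * zeta F G.

(* The unique coefficients of v in the basis of simple functions; see
   [mobiusK] and [expansionK]. *)
Definition mobius v : member S -> R :=
  xget (fun=> 0) [set b | expansion b = v].

Definition pos_part v : member S -> R :=
  fun G => \sum_(F | 0 <= mobius v F) mobius v F * zeta F G.

Definition neg_part v : member S -> R :=
  fun G => \sum_(F | mobius v F <= 0) (- mobius v F) * zeta F G.

Definition feasible v : set (N -> R) :=
  [set x | (forall i, 0 <= x i) /\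
           (forall G, v G <= \sum_(i in val G) x i)].

Definition costs f v : set R :=
  [set \sum_i f i * x i | x in feasible v].

(* The minimum of [costs f v]; the default 0 of [xget] is never used, as the
   minimum is attained by [belief_integralP]. *)
Definition belief_integral f v : R :=
  xget 0 (costs f v `&` lbound (costs f v)).

(* For belief functions this agrees with [belief_integral], see
   [system_integral_belief]. *)
Definition system_integral f v : R :=
  belief_integral f (pos_part v) - belief_integral f (neg_part v).

End Integral.

Section Monge.
Variables (R : realType) (N : finType) (S : ordered_system N).
Variables (m : nat) (idx : 'I_m -> member S).

(* [monge_run X c y ybar]: from the state (X, c, y), some sequence of choices
   of the minimizers p makes the algorithm stop with output ybar. *)
Inductive monge_run :
  {set N} -> (N -> R) -> (member S -> R) -> (member S -> R) -> Prop :=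
| monge_stop (X : {set N}) c y :
    (forall G : member S, ~~ (val G \subset X)) -> monge_run X c y y
| monge_step (X : {set N}) c y (i : 'I_m) (p : N) ybar :
    let M := idx i in
    val M \subset X ->
    (forall j : 'I_m, val (idx j) \subset X -> (i <= j)%N) ->
    p \in val M ->
    (forall j, j \in val M -> c p <= c j) ->
    monge_run (X :\ p)%SET
      (fun j => c j - c p * (j \in val M)%:R)
      (fun G => if G == M then c p else y G)
      ybar ->
    monge_run X c y ybar.

Definition monge_output (f : N -> R) (ybar : member S -> R) : Prop :=
  monge_run [set: N]%SET f (fun=> 0) ybar.

End Monge.

Section WellDefinedness.
Variables (R : realType) (N : finType) (S : ordered_system N).
Implicit Types (F G : member S) (v b : member S -> R) (f x : N -> R).

Lemma expansion_eq0 b : (forall G, expansion b G = 0) -> forall F, b F = 0.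
Proof.
move=> b0 F.
have [n] := ubnP #|[set G | prec G F]%SET|.
elim: n F => // n IH F; rewrite ltnS => leFn.
have := b0 F; rewrite /expansion (bigD1 F) //= /zeta prec_refl mulr1.
rewrite big1 ?addr0 // => G nGF.
case: (boolP (prec G F)) => [GF|_]; last by rewrite mulr0.
rewrite IH ?mul0r //; apply: leq_trans leFn.
apply: proper_card; apply/properP; split.
  by apply/fintype.subsetP => H; rewrite !inE => /prec_trans; exact.
exists F; rewrite inE ?prec_refl //.
apply: contra nGF => FG; apply/eqP; apply: (@prec_anti _ S).
by rewrite GF FG.
Qed.

Lemma expansion_inj : injective (@expansion R N S).
Proof.
move=> b1 b2 e; apply/funext => F; apply/eqP; rewrite -subr_eq0; apply/eqP.
apply: (expansion_eq0 (b := fun F => b1 F - b2 F)) => G.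
have := congr1 (fun h => h G) e; rewrite /expansion => eG.
under eq_bigr do rewrite mulrBl.
by rewrite sumrB eG subrr.
Qed.

Lemma mobiusK v : expansion (mobius v) = v.
Proof.
apply: (@xgetPex _ _ [set b | expansion b = v]).
pose A : 'M[R]_#|{: member S}| :=
  \matrix_(i, j) zeta R (enum_val i) (enum_val j).
have AE (u : 'rV[R]__) G :
    (u *m A) 0 (enum_rank G) = expansion (fun F => u 0 (enum_rank F)) G.
  rewrite mxE /expansion.
  rewrite (reindex (fun i : 'I_#|{: member S}| => enum_val i)) /=; last first.
    by exists enum_rank => i _; [exact: enum_valK|exact: enum_rankK].
  by apply: eq_bigr => i _; rewrite mxE enum_rankK enum_valK.
have uA : A \in unitmx.
  rewrite -row_free_unit; apply: inj_row_free => u uA0.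
  apply/rowP => i; rewrite -(enum_valK i) mxE.
  apply: (expansion_eq0 (b := fun F => u 0 (enum_rank F))) => G.
  by rewrite -AE uA0 mxE.
pose w := \row_i v (enum_val i) : 'rV[R]_#|{: member S}|.
exists (fun F => (w *m invmx A) 0 (enum_rank F)).
by apply/funext => G; rewrite -AE mulmxKV // mxE enum_rankK.
Qed.

Lemma expansionK b : mobius (expansion b) = b.
Proof. by apply: expansion_inj; rewrite mobiusK. Qed.

Lemma belief_integralP f v : (forall i, 0 <= f i) ->
  (costs f v `&` lbound (costs f v)) (belief_integral f v).
Proof.
move=> f0; apply: xgetPex.
pose K := \sum_F `|v F|.
have K0 : 0 <= K by apply: sumr_ge0.
have vK G : v G <= K.
  apply: le_trans (ler_norm _) _; rewrite /K (bigD1 G) //= lerDl.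
  exact: sumr_ge0.
have truncK x : feasible v x ->
    feasible v (fun i => Num.min (x i) K).
  move=> [x0 xv]; split => [i|G]; first by rewrite le_min x0 K0.
  case: (boolP [exists i in val G, K <= x i]).
    move=> /existsP[i /andP[iG Kx]]; rewrite (bigD1 i) //= min_r //.
    apply: le_trans (vK G) _; rewrite lerDl; apply: sumr_ge0 => j _.
    by rewrite le_min x0 K0.
  move=> /existsPn nK; rewrite (eq_bigr x) // => i iG.
  by move: (nK i); rewrite iG /= -ltNge => /ltW /min_l.
pose T : topologicalType := prod_topology (fun _ : N => R : topologicalType).
have cpr i : continuous (fun x : T => x i : R).
  exact: (@proj_continuous N (fun=> R) i).
have cT (P : pred N) (g : N -> R) :
    continuous (fun x : T => \sum_(i | P i) g i * x i : R).
  apply: continuous_big => [|i _ x]; first exact: add_continuous.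
  by apply: continuousM; [exact: cst_continuous|exact: cpr].
pose B : set T := [set x | forall i, `[0, K]%classic (x i)].
have cB : compact B.
  apply: (@tychonoff N (fun=> R) (fun=> `[0, K]%classic)) => i.
  exact: segment_compact.
pose C : set T := \bigcap_(G in [set: member S])
  ((fun x : T => \sum_(i in val G) 1 * x i : R) @^-1` [set r | v G <= r]).
have clC : closed C.
  apply: closed_bigI => G _.
  by apply: (continuous_closedP _).1; [exact: cT|exact: closed_ge].
have BC x : (B `&` C) x -> feasible v x.
  move=> [Bx Cx]; split => [i|G].
    by have := Bx i; rewrite /= in_itv /= => /andP[].
  by have /= := Cx G I; under eq_bigr do rewrite mul1r.
have CB x : feasible v x -> (forall i, x i <= K) -> (B `&` C) x.
  move=> [x0 xv] xK; split => [i|G _] /=; first by rewrite in_itv /= x0 xK.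
  by under eq_bigr do rewrite mul1r.
have ne : B `&` C !=set0.
  exists (fun=> K); apply: CB => //; split => // G.
  have /set0Pn[i iG] : val G != finset.set0.
    by apply: contraNneq (family_neq0 S) => <-; exact: (valP G).
  rewrite (bigD1 i) //=; apply: le_trans (vK G) _; rewrite lerDl.
  exact: sumr_ge0.
have [c /set_mem BCc cmin] := compact_EVT_min ne (compact_closedI cB clC)
  (continuous_subspaceT (cT predT f)).
exists (\sum_i f i * c i); split; first by exists c => //; exact: BC.
move=> _ [x fx <-].
have fxK := truncK _ fx.
apply: (@le_trans _ _ (\sum_i f i * Num.min (x i) K)).
  by apply: cmin; apply/mem_set/CB => // i; rewrite ge_min lexx orbT.
by apply: ler_sum => i _; apply: ler_wpM2l => //; rewrite ge_min lexx.
Qed.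

Lemma system_integral_belief f v : (forall i, 0 <= f i) ->
  (forall F, 0 <= mobius v F) -> system_integral f v = belief_integral f v.
Proof.
move=> f0 v0; rewrite /system_integral.
have -> : pos_part v = v.
  rewrite -[RHS]mobiusK; apply/funext => G; rewrite /pos_part /expansion.
  by apply: eq_bigl => F; rewrite v0.
have -> : neg_part v = fun=> 0.
  apply/funext => G; rewrite /neg_part big1 // => F vF.
  by rewrite (_ : mobius v F = 0) ?oppr0 ?mul0r //; apply/le_anti/andP.
suff -> : belief_integral f (fun _ : member S => 0 : R) = 0 by rewrite subr0.
have [[x [x0 _] <-] lb] := belief_integralP (fun _ : member S => 0 : R) f0.
apply/le_anti/andP; split; last first.
  by apply: sumr_ge0 => i _; rewrite mulr_ge0.
apply: lb; exists (fun=> 0); last by rewrite big1 // => i _; rewrite mulr0.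
by split => // G; rewrite big1.
Qed.

End WellDefinedness.

(* Main.v *)
(** The greedy output is feasible for the linear program dual to the one
    defining the integral, so by weak duality it suffices to match its value by
    a primal solution; as belief functions are conic combinations of simple
    functions, it suffices to do this for each [zeta F].  There a 0/1 solution
    works, namely the indicator of a set [Q] built by running the algorithm
    backwards.  By (IS0) a set [M] picked from [F(X)] lies above every member of
    [F(X)] it meets, so only steps with [M] above [F] matter, and then [M] is
    the top of [[F)] in [F(X)]; the pivot [p] joins [Q] iff [Q] misses [M].
    That [Q] still meets a member [G] through [p] when [p] is not added follows
    from the meets of (IS1) and consecutivity. *)
Require Import Defs.
From mathcomp Require Import all_boot all_order all_algebra.
From mathcomp Require Import all_classical all_reals all_analysis.
From mathcomp Require Import lra.

Set Implicit Arguments.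
Unset Strict Implicit.
Unset Printing Implicit Defensive.

Import Order.TTheory GRing.Theory Num.Theory.

Local Open Scope ring_scope.

Section Transversal.
Variables (N : finType) (S : ordered_system N).
Implicit Types (F G H J K M : member S) (X Q : {set N}) (p q : N).

Lemma min_index_maximal m (idx : 'I_m -> member S) X (i : 'I_m) J :
  indexing idx -> (forall j, val (idx j) \subset X -> (i <= j)%N) ->
  val J \subset X -> prec (idx i) J -> J = idx i.
Proof.
move=> [[g _ gK] mon] imin; rewrite -(gK J) => JX /mon le_ji.
by congr idx; apply/val_inj/eqP; rewrite /= eqn_leq le_ji imin.
Qed.

(** All that the primal construction uses of the minimal-index choice of [M]. *)
Definition maximal_in X M : Prop :=
  val M \subset X /\ forall J, val J \subset X -> prec M J -> J = M.

(** The join of [M] and [G] stays inside [X], so maximality makes it [M] itself. *)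
Lemma maximal_ge_meeting X M G p : intersection_system S -> maximal_in X M ->
  val G \subset X -> p \in val M -> p \in val G -> prec G M.
Proof.
move=> [_ IS] [MX Mmax] GX pM pG.
have [|J [JMG MJ GJ]] := (IS M).1 G.
  by apply/finset.set0Pn; exists p; rewrite inE pM.
rewrite -(Mmax J) //; apply: fintype.subset_trans JMG _.
by rewrite finset.subUset MX.
Qed.

Lemma maximal_top X F M G : intersection_system S -> maximal_in X M ->
  prec F M -> prec F G -> val G \subset X -> prec G M.
Proof.
move=> [_ IS] [MX Mmax] FM FG GX.
have [J [K [JMG _ _ _ [MJ GJ]]]] := (IS F).2 M G FM FG.
rewrite -(Mmax J) //; apply: fintype.subset_trans JMG _.
by rewrite finset.subUset MX.
Qed.

(* The chain condition on the private members [T q] is what forces a later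
   top member to contain at most one point of [Q]. *)
Definition chain_transversal F X Q (T : N -> member S) : Prop :=
  [/\ forall G, prec F G -> val G \subset X -> exists2 q, q \in Q & q \in val G,
      forall q, q \in Q -> [/\ q \in val (T q), val (T q) \subset X & prec F (T q)],
      forall q q', q \in Q -> q' \in Q -> q' \in val (T q) -> q' = q &
      forall q q', q \in Q -> q' \in Q -> prec (T q) (T q') \/ prec (T q') (T q)].

Lemma chain_transversal_step F X M p Q T : intersection_system S ->
  maximal_in X M -> p \in val M -> chain_transversal F (X :\ p)%SET Q T ->
  (~~ prec F M -> chain_transversal F X Q T /\ Q :&: val M = finset.set0) /\
  (prec F M ->
   (chain_transversal F X Q T /\ exists q, Q :&: val M = [set q]%SET) \/
   (chain_transversal F X (p |: Q)%SET (fun q => if q == p then M else T q) /\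
    Q :&: val M = finset.set0)).
Proof.
move=> IS Mmax pM [hit TP Tpriv Tch].
have [MX _] := Mmax.
have D1X G : val G \subset (X :\ p)%SET -> val G \subset X.
  by move/fintype.subset_trans; apply; exact: finset.subD1set.
have XD1 G : val G \subset X -> p \notin val G -> val G \subset (X :\ p)%SET.
  by move=> GX pG; rewrite finset.subsetD1 GX.
have TX q : q \in Q -> [/\ q \in val (T q), val (T q) \subset X & prec F (T q)].
  by move=> /TP[? ? ?]; split => //; exact: D1X.
have pT q : q \in Q -> p \notin val (T q).
  by move=> /TP[_ + _]; rewrite finset.subsetD1 => /andP[].
split=> [nFM|FM].
  (* A member of F(X) above [F] that met [M] would lie below [M], forcing [prec F M]. *)
  have above G q : prec F G -> val G \subset X -> q \in val M -> q \notin val G.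
    move=> FG GX qM; apply: contra nFM => qG.
    exact: prec_trans FG (maximal_ge_meeting IS Mmax GX qM qG).
  split; last first.
    apply/eqP; rewrite finset.setI_eq0; apply/fintype.pred0P => q /=.
    apply/negP => /andP[qQ qM]; have [qT TqX FT] := TX q qQ.
    by have := above _ _ FT TqX qM; rewrite qT.
  split=> // G FG GX; apply: hit => //; apply: XD1 => //.
  exact: above FG GX pM.
have top G : prec F G -> val G \subset X -> prec G M.
  by move=> FG GX; exact: maximal_top IS Mmax FM FG GX.
have [QM0|/finset.set0Pn[q]] := eqVneq (Q :&: val M) finset.set0.
  (* [M] can serve as private member of [p]: [Q] misses [M], the old [T q] avoid [p], and [M] is
     above them all. *)
  right; split=> //.
  have notM q : q \in Q -> q \notin val M.
    by move=> qQ; apply/negP => qM; move/setP: QM0 => /(_ q); rewrite !inE qQ qM.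
  have npQ q : q \in Q -> (q == p) = false.
    by move=> /notM; apply: contraNF => /eqP->.
  split.
  - move=> G FG GX; case: (boolP (p \in val G)) => pG.
      by exists p => //; rewrite !inE eqxx.
    have [q qQ qG] := hit G FG (XD1 G GX pG).
    by exists q => //; rewrite !inE qQ orbT.
  - move=> q; rewrite !inE; case: eqP => [->|_] //= qQ; exact: TX.
  - move=> q q'; rewrite !inE; case: (q =P p) => [->|_] /=.
      by case: (q' =P p) => //= _ _ /notM/negP.
    move=> qQ; case: (q' =P p) => [->|_] /= q'Q; last exact: Tpriv.
    by move/negP: (pT q qQ).
  - move=> q q'; rewrite !inE; case: (q =P p) => [_|_] /=;
      case: (q' =P p) => [_|_] //=; first by left; exact: prec_refl.
    + by move=> _ /TX[_ ? ?]; right; exact: top.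
    + by move=> /TX[_ ? ?] _; left; exact: top.
    + exact: Tch.
rewrite inE => /andP[qQ qM]; left.
have [[cons IS01] [qT TqX FT]] := (IS, TX q qQ).
split; last first.
  exists q; apply/setP => q'; rewrite !inE; apply/andP/eqP => [[q'Q q'M]|-> //].
  have [q'T Tq'X FT'] := TX q' q'Q.
  (* The smaller of [T q] and [T q'] shares its own point with [M]; consecutivity puts that point
     into the larger one, whose privacy gives [q' = q]. *)
  have [le|le] := Tch q q' qQ q'Q.
    apply/esym/(Tpriv q') => //.
    by apply: (fintype.subsetP (cons _ _ _ le (top _ FT' Tq'X))); rewrite inE qT.
  apply/(Tpriv q) => //.
  by apply: (fintype.subsetP (cons _ _ _ le (top _ FT TqX))); rewrite inE q'T.
split=> // G FG GX; case: (boolP (p \in val G)) => pG; last first.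
  exact: hit FG (XD1 G GX pG).
(* Let [K] be a meet of [G] and [T q]. It avoids [p]: otherwise [K], [T q], [M] in consecutive
   position would put [p] into [T q]. Hence [Q] hits [K]. *)
have [_ [K [_ KGT FK [KG KT] _]]] := (IS01 F).2 G (T q) FG FT.
have pK : p \notin val K.
  apply: contra (pT q qQ) => pK.
  by apply: (fintype.subsetP (cons _ _ _ KT (top _ FT TqX))); rewrite inE pK.
have KX : val K \subset X.
  by apply: fintype.subset_trans KGT _; rewrite finset.subUset GX.
have [q' q'Q q'K] := hit K FK (XD1 K KX pK); exists q' => //.
(* If the point hitting [K] lies in [T q], it is [q], which is also in [M]; consecutivity along [K],
   [G], [M] moves it into [G]. *)
have := fintype.subsetP KGT _ q'K; rewrite inE => /orP[//|q'T].
apply: (fintype.subsetP (cons _ _ _ KG (top _ FG GX))).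
by rewrite inE q'K (Tpriv q q' qQ q'Q q'T).
Qed.

End Transversal.

Section MongeDuality.
Variables (R : realType) (N : finType) (S : ordered_system N).
Variables (m : nat) (idx : 'I_m -> member S).
Implicit Types (F G M : member S) (X Q : {set N}).
Implicit Types (c f x : N -> R) (y b v u ybar : member S -> R).

Lemma sum_update y u M (a : R) : y M = 0 ->
  \sum_G (if G == M then a else y G) * u G = \sum_G y G * u G + a * u M.
Proof.
move=> yM; rewrite (bigD1 M) //= eqxx addrC; congr (_ + _).
rewrite [RHS](bigD1 M) //= yM mul0r add0r.
by apply: eq_bigr => G /negPf ->.
Qed.

(** Preserves the invariant that [y] vanishes on the members still available, so no assignment
    overwrites an earlier value. *)
Lemma update_eq0 X y M p (a : R) : p \in val M ->
  (forall G, val G \subset X -> y G = 0) ->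
  forall G, val G \subset (X :\ p)%SET -> (if G == M then a else y G) = 0.
Proof.
move=> pM y0 G; rewrite finset.subsetD1 => /andP[GX pG].
by case: eqP pG => [->|_ _]; [rewrite pM|exact: y0].
Qed.

(** Each step moves [c p] from the residual cost of every [j] in [M] to its dual load, keeping their
    sum; slack appears only at the stop, where a nonnegative residual is dropped. *)
Lemma monge_run_dual_feasible X c y ybar : monge_run idx X c y ybar ->
  (forall j, 0 <= c j) -> (forall G, 0 <= y G) ->
  (forall G, val G \subset X -> y G = 0) ->
  (forall G, 0 <= ybar G) /\
  (forall j, \sum_G ybar G * (j \in val G)%:R <=
             \sum_G y G * (j \in val G)%:R + c j).
Proof.
elim=> {X c y ybar} [X c y _ c0 y0 _|X c y i p ybar M MX _ pM cmin _ IH c0 y0 yX].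
  by split=> // j; rewrite lerDl.
have [j|G||yb0 ybc] := IH.
- case: (boolP (j \in val M)) => jM; rewrite ?mulr1 ?mulr0 ?subr0 //.
  by rewrite subr_ge0 cmin.
- by case: ifP.
- exact: update_eq0.
split=> // j; apply: le_trans (ybc j) _.
by rewrite sum_update ?yX //; lra.
Qed.

Lemma monge_run_primal F X c y ybar : intersection_system S -> indexing idx ->
  monge_run idx X c y ybar -> (forall G, val G \subset X -> y G = 0) ->
  exists Q T, chain_transversal F X Q T /\
    \sum_G ybar G * zeta R F G = \sum_G y G * zeta R F G + \sum_(q in Q) c q.
Proof.
move=> IS hidx.
elim=> {X c y ybar} [X c y Xstop _|X c y i p ybar M MX imin pM _ _ IH yX].
  exists finset.set0, (fun=> F); rewrite big_set0 addr0; split=> //.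
  by split=> [G _ GX|q|q q'|q q']; rewrite ?inE //; case/negP: (Xstop G).
have [|Q [T [ct ->]]] := IH; first exact: update_eq0.
rewrite sum_update ?yX // sumrB -mulr_sumr.
(* Passing to the reduced costs lowers the cost of [Q] by [c p] times this cardinality, which must
   balance the new dual term [c p * zeta R F M]. *)
have -> : \sum_(q in Q) (q \in val M)%:R = #|Q :&: val M|%:R :> R.
  rewrite -sum1_card natr_sum [RHS]big_mkcond [LHS]big_mkcond /=.
  by apply: eq_bigr => q _; rewrite inE; do 2 case: (_ \in _).
have Mmax : maximal_in X M.
  by split=> // J; exact: min_index_maximal.
have [out into] := chain_transversal_step IS Mmax pM ct.
have pQ : p \notin Q.
  apply/negP => pQ; have [_ /(_ p pQ)[pT]] := ct.
  by rewrite finset.subsetD1 pT andbF.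
rewrite /zeta; case: (boolP (prec F M)) => [/into|/out].
  case=> [[ct' [q ->]]|[ct' ->]].
    by exists Q, T; split=> //; rewrite cards1 /=; lra.
  eexists; eexists; split; first exact: ct'.
  by rewrite big_setU1 //= cards0 /=; lra.
by case=> ct' ->; exists Q, T; split=> //; rewrite cards0 /=; lra.
Qed.

Lemma monge_weak_duality f ybar v x : (forall i, 0 <= f i) ->
  monge_output idx f ybar -> feasible v x ->
  \sum_F ybar F * v F <= \sum_i f i * x i.
Proof.
move=> f0 run [x0 xv].
have [||yb0 ybf] := monge_run_dual_feasible run f0; try by [].
apply: le_trans (_ : \sum_F \sum_i ybar F * (i \in val F)%:R * x i <= _).
  apply: ler_sum => F _; under eq_bigr do rewrite -mulrA.
  rewrite -mulr_sumr; apply: ler_wpM2l => //.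
  apply: le_trans (xv F) _; rewrite big_mkcond /=; apply: ler_sum => i _.
  by case: ifP; rewrite ?mul1r ?mul0r.
rewrite exchange_big /=; apply: ler_sum => i _.
rewrite -mulr_suml; apply: ler_wpM2r => //.
apply: le_trans (ybf i) _.
by rewrite big1 ?add0r // => G _; rewrite mul0r.
Qed.

Lemma monge_zeta_primal f ybar F : intersection_system S -> indexing idx ->
  monge_output idx f ybar -> exists2 x, feasible (zeta R F) x &
    \sum_i f i * x i = \sum_G ybar G * zeta R F G.
Proof.
move=> IS hidx run.
have [//|Q [T [[hit _ _ _] ->]]] := monge_run_primal F IS hidx run.
exists (fun i => (i \in Q)%:R); last first.
  rewrite [X in _ = X + _]big1 ?add0r => [|G _]; last by rewrite mul0r.
  by rewrite [RHS]big_mkcond /=; apply: eq_bigr => i _; case: ifP;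
    rewrite ?mulr1 ?mulr0.
split=> [i|G]; first exact: ler0n.
rewrite /zeta; case: (boolP (prec F G)) => FG; last exact: sumr_ge0.
have [q qQ qG] := hit G FG (finset.subsetT _).
by rewrite (bigD1 q) //= qQ lerDl sumr_ge0.
Qed.

Lemma belief_integral_monge f ybar b : intersection_system S ->
  indexing idx -> (forall i, 0 <= f i) -> monge_output idx f ybar ->
  (forall F, 0 <= b F) ->
  belief_integral f (expansion b) = \sum_F ybar F * expansion b F.
Proof.
move=> IS hidx f0 run b0.
have [[z zfeas <-] lb] := belief_integralP (expansion b) f0.
apply/le_anti/andP; split; last exact: monge_weak_duality.
have /choice[x xP] F : exists x, feasible (zeta R F) x /\
    \sum_i f i * x i = \sum_G ybar G * zeta R F G.
  by have [x] := monge_zeta_primal F IS hidx run; exists x.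
(* Since [b] is nonnegative, weighting the optimal solutions for the simple functions by [b] keeps
   feasibility and attains the dual value. *)
apply: lb; exists (fun i => \sum_F b F * x F i).
  split=> [i|G].
    by apply: sumr_ge0 => F _; rewrite mulr_ge0 //; have [[]] := xP F.
  rewrite exchange_big /=; apply: ler_sum => F _; rewrite -mulr_sumr.
  by apply: ler_wpM2l => //; have [[]] := xP F.
under eq_bigr do rewrite mulr_sumr.
rewrite exchange_big /=; under [RHS]eq_bigr do rewrite mulr_sumr.
rewrite [RHS]exchange_big /=; apply: eq_bigr => F _.
under eq_bigr do rewrite mulrCA.
under [RHS]eq_bigr do rewrite mulrCA.
by rewrite -!mulr_sumr (xP F).2.
Qed.

Lemma system_integral_monge f ybar v : intersection_system S ->
  indexing idx -> (forall i, 0 <= f i) -> monge_output idx f ybar ->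
  system_integral f v = \sum_F ybar F * v F.
Proof.
move=> IS hidx f0 run; rewrite /system_integral.
(* Extending by zero turns both parts into full expansions with nonnegative coefficients. *)
pose bp F := if 0 <= mobius v F then mobius v F else 0.
pose bn F := if mobius v F <= 0 then - mobius v F else 0.
have -> : pos_part v = expansion bp.
  apply/funext => G; rewrite /pos_part big_mkcond; apply: eq_bigr => F _.
  by rewrite /bp; case: ifP; rewrite ?mul0r.
have -> : neg_part v = expansion bn.
  apply/funext => G; rewrite /neg_part big_mkcond; apply: eq_bigr => F _.
  by rewrite /bn; case: ifP; rewrite ?mul0r.
rewrite !(belief_integral_monge IS hidx f0 run) //; first last.
- by move=> F; rewrite /bp; case: ifP.
- by move=> F; rewrite /bn; case: ifP => //; rewrite oppr_ge0.
rewrite -sumrB; apply: eq_bigr => G _; rewrite -mulrBr; congr (_ * _).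
rewrite -[in RHS](mobiusK v) /expansion -sumrB; apply: eq_bigr => F _.
rewrite -mulrBl; congr (_ * _); rewrite /bp /bn.
by case: (ltrgt0P (mobius v F)) => [_|_|->]; rewrite ?subr0 ?opprK ?add0r ?oppr0.
Qed.

End MongeDuality.

Theorem theorem3 (R : realType) (N : finType) (S : ordered_system N)
    (m : nat) (idx : 'I_m -> member S) (f : N -> R) (ybar : member S -> R)
    (hS : intersection_system S) (hidx : indexing idx)
    (hf : forall i, 0 <= f i) (hy : monge_output idx f ybar)
    (v : member S -> R) :
  \sum_F ybar F * v F = system_integral f v /\
  system_integral f v = \sum_F mobius v F * system_integral f (zeta R F).
Proof.
(* One run represents the integral of every valuation, so the integral is linear in [u]. *)
have integralE := fun u => system_integral_monge u hS hidx hf hy.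
rewrite integralE; split=> //.
under [RHS]eq_bigr do rewrite integralE mulr_sumr.
rewrite [RHS]exchange_big /=; apply: eq_bigr => G _.
rewrite -[in LHS](mobiusK v) /expansion mulr_sumr.
by apply: eq_bigr => F _; rewrite mulrCA.
Qed.
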